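(* Let $n$ be a positive integer and $\zeta=\zeta_n=e^{2\pi i/n}$. There is a bijection between $\mathcal{A}_n$ and $\mathcal{B}_n$ under which the polynomial $x^m-1-x^{k_1}-x^{k_2}-\cdots-x^{k_\ell}\in\mathcal{A}_n$ (with $1\le k_1<\cdots<k_\ell<m$) corresponds to the set $\{\zeta^{n-m},\zeta^{n-m+k_1},\ldots,\zeta^{n-m+k_\ell}\}\in\mathcal{B}_n$.
   Context: $\Phi_n(x)$ denotes the $n$-th cyclotomic polynomial. $\mathcal{A}_n$ is the set of polynomials $f(x)\in\mathbb{Z}[x]$ such that $\Phi_n(x)$ divides $f(x)$ and $f(x)=x^m-a_{m-1}x^{m-1}-\cdots-a_1x-1$ for some integer $m<n$ with $a_i\in\{0,1\}$ for $1\le i<m$. $R_n=\{\zeta_n^k: 0\le k\le n-1\}$ is the set of $n$-th roots of unity; for $T\subseteq R_n$, $\sigma(T)=\sum_{\alpha\in T}\alpha$; and $\mathcal{B}_n=\{T\subseteq R_n\setminus\{1\}: \sigma(T)=1\}$. *)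

(* Defs.v *)
From HB Require Import structures.
From mathcomp Require Import all_boot all_order all_algebra all_field.
From mathcomp Require Import finmap complex.
From mathcomp Require Import all_classical all_reals all_analysis.

Set Implicit Arguments.
Unset Strict Implicit.
Unset Printing Implicit Defensive.

Import Order.TTheory GRing.Theory Num.Theory.
Local Open Scope ring_scope.
Local Open Scope complex_scope.

Definition zeta (R : realType) (n : nat) : R[i] :=
  cos (2 * pi / n%:R) +i* sin (2 * pi / n%:R).

(* Divisibility by 'Phi_n is written out with a cofactor in Z[x], because %| on
   {poly int} is defined by pseudo-division. The bound 0 < m is implicit in the
   shape x^m - ... - 1: for m = 0 it would degenerate to the zero polynomial. *)
Definition calA (n : nat) : set {poly int} :=
  [set f : {poly int} |
    (exists q : {poly int}, f = q * 'Phi_n) /\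
    exists (m : nat) (a : nat -> int),
      [/\ (0 < m < n)%N,
          forall i : nat, (1 <= i < m)%N -> a i = 0 \/ a i = 1
        & f = 'X^m - \sum_(1 <= i < m) a i *: 'X^i - 1]]%classic.

Definition unity_roots (R : realType) (n : nat) : {fset R[i]} :=
  [fset zeta R n ^+ k | k in iota 0 n]%fset.

Definition sigma (R : realType) (T : {fset R[i]}) : R[i] := \sum_(x <- T) x.

Definition calB (R : realType) (n : nat) : set {fset R[i]} :=
  [set T : {fset R[i]} |
    (T `<=` unity_roots R n `\ 1)%fset /\ sigma T = 1]%classic.
Arguments calB : clear implicits.

(* Main.v *)
(** If [f = x^m - 1 - x^k1 - ... - x^kl] vanishes at the primitive root [zeta], then
    multiplying [f(zeta) = 0] by [zeta^(n-m)] gives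
    [1 = zeta^(n-m) + zeta^(n-m+k1) + ... + zeta^(n-m+kl)], whose exponents are
    distinct and lie in [1, n-1]; conversely [m] is recovered from the least exponent
    [n - m] of the set. That [f(zeta) = 0] forces ['Phi_n] to divide [f] follows from
    the irreducibility of ['Phi_n] over Q, which the library provides through minimal
    polynomials in [algC]: [gcd(f, 'Phi_n)] over Q is not constant since it
    vanishes at [zeta], so it has a root in [algC]. *)

Require Import Defs.
From mathcomp Require Import all_boot all_order all_algebra all_field.
From mathcomp Require Import finmap complex.
From mathcomp Require Import all_classical all_reals all_analysis.
From mathcomp Require Import lra zify.
Import Order.TTheory GRing.Theory Num.Theory.
Local Open Scope ring_scope.

(** * The number [zeta R n] is a primitive [n]-th root of unity *)

Section Zeta.
Variable R : realType.
Local Open Scope complex_scope.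

Lemma cis_exp (x : R) (k : nat) :
  (cos x +i* sin x) ^+ k = cos (x *+ k) +i* sin (x *+ k).
Proof.
elim: k => [|k IH]; first by rewrite expr0 mulr0n cos0 sin0.
rewrite exprS IH mulrS cosD sinD; apply/eqP; rewrite eq_complex /=.
by rewrite eqxx /= addrC eqxx.
Qed.

(** By the half-angle formula [cos x] is 1 minus twice the square of [sin (x / 2)], and this sine is
    positive because [x / 2] lies strictly between 0 and [pi]. *)
Lemma cos_lt1 (x : R) : 0 < x < pi *+ 2 -> cos x < 1.
Proof.
move=> /andP[x0 x2].
have -> : x = (x / 2) *+ 2 by lra.
rewrite cos_mulr2n cos2sin2.
have : 0 < sin (x / 2) by apply: sin_gt0_pi; lra.
move=> /(exprn_gt0 2); lra.
Qed.

Lemma zeta_prim_root {n : nat} (n_gt0 : (0 < n)%N) : n.-primitive_root (zeta R n).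
Proof.
have nR : 0 < n%:R :> R by rewrite ltr0n.
apply/andP; split=> //; apply/forallP=> i; rewrite unity_rootE /zeta cis_exp.
set x := 2 * pi / n%:R.
have [->|ne] := eqVneq i.+1 n.
  have -> : x *+ n = pi *+ 2 by rewrite /x -mulr_natr mulfVK ?lt0r_neq0// mulr_natl.
  by rewrite cos2pi sin2pi eqxx.
have lt_in : (i.+1 < n)%N by rewrite ltn_neqAle ne ltn_ord.
(* The real part alone excludes a smaller order: the angle [x *+ i.+1] lies strictly between 0 and a
   full turn. *)
apply/eqP/negbTE; rewrite eq_complex /= negb_and; apply/orP; left.
rewrite lt_eqF// cos_lt1//.
have pi_gt0 := pi_gt0 R; have x0 : 0 < x by rewrite /x divr_gt0// mulr_gt0.
rewrite pmulrn_lgt0// x0 /=.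
have -> : pi *+ 2 = x *+ n.
  by rewrite /x -[RHS]mulr_natr mulfVK ?lt0r_neq0// mulr_natl.
by rewrite ltr_pMn2l.
Qed.

End Zeta.

(** * Vanishing at a primitive root and divisibility by ['Phi_n] in Z[x] *)

Section Cyclotomic.
Variable F : numFieldType.

Local Notation pZ := (map_poly (intr : int -> F)).

(** As ['X^n - 1] is the product of the ['Phi_d] with [d] dividing [n], some ['Phi_d] vanishes at
    [z]. This factor also divides ['X^d - 1], so [z ^+ d = 1], and primitivity forces [d = n]. *)
Lemma root_Cyclotomic_prim {n : nat} {z : F} :
  n.-primitive_root z -> root (pZ 'Phi_n) z.
Proof.
move=> prim_z; have n_gt0 := prim_order_gt0 prim_z.
have : root (pZ ('X^n - 1)) z.
  by rewrite rmorphB /= map_polyXn rmorph1 rootE !hornerE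
    (prim_expr_order prim_z) subrr.
rewrite -prod_Cyclotomic// rmorph_prod /= rootE horner_prod prodf_seq_eq0.
case/hasP=> d; rewrite -dvdn_divisors// => dn /andP[_ zd].
have d_gt0 := dvdn_gt0 n_gt0 dn.
suff /eqP <- : d == n by [].
rewrite eqn_dvd dn (prim_order_dvd prim_z) /= -subr_eq0.
have -> : z ^+ d - 1 = (pZ ('X^d - 1)).[z].
  by rewrite rmorphB /= map_polyXn rmorph1 !hornerE.
rewrite -prod_Cyclotomic// rmorph_prod /= horner_prod prodf_seq_eq0.
by apply/hasP; exists d; rewrite // -dvdn_divisors.
Qed.

Lemma Cyclotomic_dvd_root {n : nat} {z : F} (f : {poly int}) :
  n.-primitive_root z -> root (pZ f) z -> exists q, f = q * 'Phi_n.
Proof.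
move=> prim_z fz.
have Phiz := root_Cyclotomic_prim prim_z.
pose pZQ := map_poly (intr : int -> rat).
have map_QF (p : {poly int}) : map_poly (ratr : rat -> F) (pZQ p) = pZ p.
  by rewrite -map_poly_comp; apply: eq_map_poly => x /=; rewrite ratr_int.
have map_QC (p : {poly int}) :
    map_poly (ratr : rat -> algC) (pZQ p) = map_poly intr p.
  by rewrite -map_poly_comp; apply: eq_map_poly => x /=; rewrite ratr_int.
pose g := gcdp (pZQ f) (pZQ 'Phi_n).
have gz : root (map_poly (ratr : rat -> F) g) z.
  by rewrite gcdp_map root_gcd !map_QF fz.
have sg : size g != 1.
  apply/negP=> /size_poly1P[c c0 gc]; move: gz.
  by rewrite gc map_polyC rootC /= fmorph_eq0 (negbTE c0).
have /closed_rootP[w] : size (map_poly (ratr : rat -> algC) g) != 1%N.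
  by rewrite size_map_poly.
rewrite gcdp_map root_gcd !map_QC => /andP[fw Phiw].
have [w0 prim_w0] := C_prim_root_exists (prim_order_gt0 prim_z).
have prim_w : n.-primitive_root w.
  by move: Phiw; rewrite (Cintr_Cyclotomic prim_w0) root_cyclotomic.
(* Since [w] is a primitive [n]-th root, its minimal polynomial over Q is ['Phi_n]; as [f] vanishes
   at [w], ['Phi_n] divides [f] over Q. *)
have [p [Dp mp] dvd_p] := minCpolyP w.
have Ep : p = pZQ 'Phi_n.
  apply: (map_poly_inj (ratr : {rmorphism rat -> algC})).
  by rewrite -Dp map_QC (minCpoly_cyclotomic prim_w) (Cintr_Cyclotomic prim_w).
have : p %| pZQ f by rewrite -dvd_p map_QC.
rewrite Ep => dvd.
(* Descent from Q to Z: ['Phi_n] is monic, so Euclidean division takes place in Z[x]. Over Q the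
   remainder is a multiple of ['Phi_n] of smaller degree, hence zero. *)
have monP := Cyclotomic_monic n.
exists (Pdiv.Ring.rdivp f 'Phi_n).
have Df := Pdiv.RingMonic.rdivp_eq monP f.
rewrite {1}Df.
suff -> : Pdiv.Ring.rmodp f 'Phi_n = 0 by rewrite addr0.
set r := Pdiv.Ring.rmodp _ _ in Df *.
have : pZQ 'Phi_n %| pZQ r.
  move: dvd; rewrite {1}Df /pZQ rmorphD rmorphM /= dvdp_addr// dvdp_mull//.
move=> dvd_r; apply/eqP/contraT => r0.
have r0Q : pZQ r != 0 by rewrite /pZQ map_poly_eq0_id0// intr_eq0 lead_coef_eq0.
have := dvdp_leq r0Q dvd_r.
rewrite !size_map_inj_poly//; try exact: intr_inj.
rewrite leqNgt Pdiv.Ring.ltn_rmodpN0//; exact: monic_neq0.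
Qed.
End Cyclotomic.

(** * The shape of the polynomials in [calA], read on coefficients *)

Lemma coef_sumZXn (A : nzRingType) (s : seq nat) (a : nat -> A) (j : nat) :
  uniq s -> (\sum_(i <- s) a i *: 'X^i)`_j = if j \in s then a j else 0.
Proof.
move=> us; rewrite coef_sum; case: ifP => js.
  rewrite (bigD1_seq j) //= coefZ coefXn eqxx mulr1 big1 ?addr0// => i ij.
  by rewrite coefZ coefXn eq_sym (negbTE ij) mulr0.
rewrite big1_seq// => i /= si; rewrite coefZ coefXn.
by case: eqP => [ji|]; rewrite ?mulr0//; rewrite ji si in js.
Qed.

(** Replaces the auxiliary sequence [a] by conditions on [f] itself, with [a i] read off as the
    negated coefficient. The constant term -1 then follows the same 0 or -1 pattern as the middle
    ones. *)
Definition calA_shape (m : nat) (f : {poly int}) :=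
  [/\ size f = m.+1, f`_m = 1, f`_0 = -1
    & forall j, (j < m)%N -> f`_j = 0 \/ f`_j = -1].

(** Common entry point for polynomials given by the set [s] of exponents with coefficient -1,
    whether [s] comes from a sequence [a], a set of roots or a list of exponents. *)
Lemma calA_shape_coef {m : nat} {f : {poly int}} (s : pred nat) :
  (0 < m)%N -> s 0%N ->
  (forall j, f`_j = (j == m)%:R - ((j < m)%N && s j)%:R) -> calA_shape m f.
Proof.
move=> m0 s0 cf; split.
- apply/eqP; rewrite eqn_leq; apply/andP; split.
    by apply/leq_sizeP => j mj; rewrite cf gtn_eqF// ltnNge (ltnW mj).
  rewrite ltnNge; apply/negP => /leq_sizeP/(_ m (leqnn _)).
  by rewrite cf eqxx ltnn.
- by rewrite cf eqxx ltnn subr0.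
- by rewrite cf ltn_eqF// m0 s0 sub0r.
- by move=> j jm; rewrite cf ltn_eqF// jm /=; case: (s j); [right|left].
Qed.

Lemma calA_shapeP {n : nat} {f : {poly int}} :
  (exists (m : nat) (a : nat -> int),
      [/\ (0 < m < n)%N,
          forall i : nat, (1 <= i < m)%N -> a i = 0 \/ a i = 1
        & f = 'X^m - \sum_(1 <= i < m) a i *: 'X^i - 1]) <->
  (exists m, (0 < m < n)%N /\ calA_shape m f).
Proof.
have coefE m (a : nat -> int) j :
    ('X^m - \sum_(1 <= i < m) a i *: 'X^i - 1 : {poly int})`_j =
    (j == m)%:R - (if (1 <= j < m)%N then a j else 0) - (j == 0%N)%:R.
  by rewrite !coefB coefXn coef1 coef_sumZXn ?iota_uniq// mem_index_iota.
split=> [[m [a [mn aP Df]]]|[m [mn [sf fm f0 fP]]]].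
  exists m; split=> //; case/andP: mn => m0 _.
  (* Index 0 is selected separately: [a 0] is unconstrained, and the constant term comes from the
     final [- 1]. *)
  apply: (@calA_shape_coef m f (fun j => (j == 0%N) || (a j == 1))) => // j.
  rewrite Df coefE; case: j => [|j] /=; first by rewrite m0 subr0.
  rewrite subr0; case: ltnP => //= jm.
  by have [|->|->] := aP j.+1; rewrite ?jm.
exists m, (fun i => - f`_i); split=> //.
  move=> i /andP[i0 im].
  by have [->|->] := fP i im; rewrite ?oppr0 ?opprK; [left|right].
case/andP: mn => m0 _.
apply/polyP=> j; rewrite coefE.
case: (posnP j) => [->|j0]; first by rewrite f0 ltn_eqF//.
rewrite subr0; case: ltngtP => [jm|mj|->].
- by rewrite sub0r opprK.
- by rewrite subr0 nth_default// sf.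
- by rewrite subr0.
Qed.

(** * The bijection between polynomials and sets of roots of unity *)

Section Correspondence.
Variables (R : realType) (n : nat).
Hypothesis n_gt0 : (0 < n)%N.
Local Notation z := (zeta R n).
Local Notation pZ := (map_poly (intr : int -> R[i])).

Lemma calAP {f : {poly int}} :
  calA n f <-> root (pZ f) z /\ exists m, (0 < m < n)%N /\ calA_shape m f.
Proof.
have prim_z := zeta_prim_root R n_gt0.
split=> [[[q Df] sf]|[fz sf]]; split; try exact/calA_shapeP.
  by rewrite Df rmorphM /= rootM root_Cyclotomic_prim ?orbT.
exact: Cyclotomic_dvd_root prim_z fz.
Qed.

Lemma zeta_exp_inj (i j : nat) :
  (i < n)%N -> (j < n)%N -> (z ^+ i == z ^+ j) = (i == j).
Proof.
move=> i_n j_n.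
by rewrite (eq_prim_root_expr (zeta_prim_root R n_gt0)) !modn_small.
Qed.

Lemma unity_rootsD1P {x : R[i]} :
  x \in (unity_roots R n `\ 1)%fset -> exists2 e, (0 < e < n)%N & x = z ^+ e.
Proof.
rewrite in_fsetD1 => /andP[x1 /imfsetP[e /=]].
rewrite mem_iota /= add0n => en xe; exists e => //; rewrite en andbT lt0n.
by apply: contraNneq x1 => e0; rewrite xe e0 expr0.
Qed.

(* The index [j = 0] is always selected for [f] in [calA n], because its constant
   term is [-1]. *)
Definition minus_one_roots (f : {poly int}) : {fset R[i]} :=
  [fset z ^+ (n - (size f).-1 + j)
    | j in [seq j <- iota 0 (size f).-1 | f`_j == -1]]%fset.

(** The guard [n - m <= e] matters: below it the truncated subtraction would return index 0, where a
    polynomial of [calA n] does have coefficient -1. *)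
Lemma mem_minus_one_roots {m : nat} {f : {poly int}} (e : nat) :
  (m <= n)%N -> size f = m.+1 -> (e < n)%N ->
  (z ^+ e \in minus_one_roots f) = (n - m <= e)%N && (f`_(e - (n - m)) == -1).
Proof.
move=> mn sf en; rewrite /minus_one_roots sf /=.
apply/imfsetP/andP => [[j /=]|[le fe]].
  rewrite mem_filter mem_iota /= add0n => /andP[fj jm] /eqP.
  rewrite zeta_exp_inj//; last by lia.
  by move=> /eqP ->; rewrite leq_addr addKn.
exists (e - (n - m))%N => /=; last by rewrite subnKC.
by rewrite mem_filter fe mem_iota /= add0n; lia.
Qed.

(** In the product of [z ^+ (n - m)] with the value of [f] at [z], the leading term contributes
    [z ^+ n = 1], and the coefficients -1 contribute exactly the negated elements of the set. *)
Lemma sigma_minus_one_roots {m : nat} {f : {poly int}} :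
  (m <= n)%N -> calA_shape m f ->
  sigma (minus_one_roots f) = 1 - z ^+ (n - m) * (pZ f).[z].
Proof.
move=> mn [sf fm f0 fP]; rewrite /sigma /minus_one_roots sf /=.
(* The exponents [n - m + j] with [j < m] stay below [n], so distinct indices give distinct roots
   and no term of the sum is lost. *)
rewrite big_imfset /=; last first.
  move=> i j /=; rewrite !mem_filter !mem_iota /= !add0n.
  move=> /andP[_ im] /andP[_ jm] /eqP.
  by rewrite zeta_exp_inj; [move/eqP/addnI|lia|lia].
rewrite undup_id ?filter_uniq ?iota_uniq// big_filter.
have -> : iota 0 m = index_iota 0 m by rewrite /index_iota subn0.
rewrite big_mkord.
rewrite (@horner_coef_wide _ m.+1) ?size_map_inj_poly ?sf//; last exact: intr_inj.
rewrite big_ord_recr /= coef_map fm /= mul1r mulrDr -exprD subnK//.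
rewrite (prim_expr_order (zeta_prim_root R n_gt0)) opprD addrCA subrr addr0.
rewrite mulr_sumr -sumrN big_mkcond /=; apply: eq_bigr => j _.
rewrite coef_map /= exprD; have [-> /=|-> /=] := fP j (ltn_ord j).
  by rewrite mul0r mulr0 oppr0.
by rewrite mulN1r mulrN opprK.
Qed.

Lemma minus_one_roots_sub {m : nat} {f : {poly int}} :
  (m < n)%N -> size f = m.+1 ->
  (minus_one_roots f `<=` unity_roots R n `\ 1)%fset.
Proof.
move=> mn sf; apply/fsubsetP => x; rewrite /minus_one_roots sf.
case/imfsetP => j /=; rewrite mem_filter mem_iota /= add0n => /andP[_ jm] ->.
rewrite in_fsetD1 -(expr0 z) zeta_exp_inj//; last by lia.
apply/andP; split; first by lia.
by apply/imfsetP; exists (n - m + j)%N => //=; rewrite mem_iota; lia.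
Qed.

Lemma sigma_eq1 {m : nat} {f : {poly int}} :
  (m <= n)%N -> calA_shape m f ->
  (sigma (minus_one_roots f) == 1) = root (pZ f) z.
Proof.
move=> mn /(sigma_minus_one_roots mn) ->.
rewrite -subr_eq0 addrAC subrr sub0r oppr_eq0 mulf_eq0 rootE expf_eq0.
by rewrite (prim_root_eq0 (zeta_prim_root R n_gt0)) gtn_eqF// andbF.
Qed.

Lemma minus_one_roots_inj {m1 m2 : nat} {f1 f2 : {poly int}} :
  (0 < m1 < n)%N -> (0 < m2 < n)%N -> calA_shape m1 f1 -> calA_shape m2 f2 ->
  minus_one_roots f1 = minus_one_roots f2 -> f1 = f2.
Proof.
move=> /andP[m10 m1n] /andP[m20 m2n] [s1 l1 z1 c1] [s2 l2 z2 c2] E.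
have M e : (e < n)%N ->
    (n - m1 <= e)%N && (f1`_(e - (n - m1)) == -1) =
    (n - m2 <= e)%N && (f2`_(e - (n - m2)) == -1).
  by move=> en; rewrite -!mem_minus_one_roots ?E// ltnW.
(* The constant term -1 puts the exponent [n - m1] in the first set, hence in the second, whose
   exponents are at least [n - m2]; the converse inequality is symmetric. *)
have Em : m1 = m2.
  have le21 : (n - m2 <= n - m1)%N.
    have /M : (n - m1 < n)%N by rewrite ltn_subrL m10.
    by rewrite subnn leqnn z1 => /esym/andP[].
  have le12 : (n - m1 <= n - m2)%N.
    have /M : (n - m2 < n)%N by rewrite ltn_subrL m20.
    by rewrite subnn leqnn z2 => /andP[].
  by move: le21 le12 m1n m2n; clear; lia.
move: M; rewrite Em in s1 l1 c1 * => M.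
apply/polyP => j; have [jm|mj] := ltnP j m2; last first.
  move: mj; rewrite leq_eqVlt => /predU1P[<-|mj]; first by rewrite l1.
  by rewrite !nth_default ?s1 ?s2.
(* Below the leading term a coefficient is 0 or -1, so knowing whether it equals -1 determines
   it. *)
have := M (n - m2 + j)%N; rewrite leq_addr addKn /= => H.
have {}H : (f1`_j == -1) = (f2`_j == -1) by apply: H; lia.
by move: H; have [->|->] := c1 j jm; have [->|->] := c2 j jm.
Qed.

Lemma minus_one_roots_surj {T : {fset R[i]}} :
  calB R n T -> exists2 f, calA n f & minus_one_roots f = T.
Proof.
move=> [/fsubsetP subT sT].
have TP x : x \in T -> exists2 e, (0 < e < n)%N & x = z ^+ e.
  by move/subT/unity_rootsD1P.
(* [T] is nonempty because an empty sum is 0, not 1. Its least exponent [e0] will be [n - m]. *)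
have exT : exists e, (0 < e < n)%N && (z ^+ e \in T).
  have [T0|[x xT]] := fset_0Vmem T.
    by move: sT; rewrite /sigma T0 big_seq_fset0 => /esym/eqP; rewrite oner_eq0.
  by have [e en xe] := TP x xT; exists e; rewrite en -xe.
case: (ex_minnP exT) => e0 /andP[/andP[e00 e0n] e0T] e0min.
pose m := (n - e0)%N.
pose f : {poly int} := 'X^m - \poly_(j < m) (z ^+ (e0 + j) \in T)%:R.
have mn : (0 < m < n)%N by rewrite /m; lia.
have coeff j : f`_j = (j == m)%:R - ((j < m)%N && (z ^+ (e0 + j) \in T))%:R.
  by rewrite coefB coefXn coef_poly; case: ltnP.
have sf : calA_shape m f.
  apply: (@calA_shape_coef _ _ (fun j => z ^+ (e0 + j) \in T)) => //.
    by case/andP: mn.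
  by rewrite addn0.
have ET : minus_one_roots f = T.
  have nm : (n - m = e0)%N by rewrite /m; lia.
  have mem e : (0 < e < n)%N -> (z ^+ e \in minus_one_roots f) = (z ^+ e \in T).
    move=> /andP[e_gt0 en]; case: sf => sf _ _ _.
    rewrite (mem_minus_one_roots (m := m))//; last by lia.
    (* Exponents below [e0] are absent from [T] by minimality; the others are [e0 + j] with [j < m],
       and [f] records them. *)
    rewrite nm coeff; have [le|lt] := leqP e0 e; last first.
      by apply/esym/negbTE/negP => eT; have := e0min e; rewrite e_gt0 en eT; lia.
    have em : (e - e0 < m)%N by rewrite ltn_sub2r.
    rewrite subnKC// em (ltn_eqF em) /=.
    by case: (z ^+ e \in T).
  have sub x : x \in minus_one_roots f -> exists2 e, (0 < e < n)%N & x = z ^+ e.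
    case: sf => sf _ _ _; case/andP: mn => _ mn.
    by move/(fsubsetP (minus_one_roots_sub mn sf))/unity_rootsD1P.
  apply/fsetP => x; apply/idP/idP => xT.
    by have [e en xe] := sub x xT; move: xT; rewrite xe mem.
  by have [e en xe] := TP x xT; move: xT; rewrite xe mem.
exists f => //; apply/calAP; split; last by exists m.
by rewrite -(sigma_eq1 (m := m)) ?ET ?sT ?leq_subr.
Qed.

Lemma minus_one_roots_bij : set_bij (calA n) (calB R n) minus_one_roots.
Proof.
split=> [f /calAP[fz [m [mn sf]]]|f g|T /minus_one_roots_surj[f fA <-]].
- case/andP: (mn) => m0 m_n; split.
    by case: sf => sf *; apply: minus_one_roots_sub m_n sf.
  by apply/eqP; rewrite (sigma_eq1 (m := m)) ?(ltnW m_n).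
- rewrite !inE => /calAP[_ [m1 [m1n s1]]] /calAP[_ [m2 [m2n s2]]].
  exact: minus_one_roots_inj m1n m2n s1 s2.
- by exists f.
Qed.

Lemma minus_one_roots_explicit {m : nat} (k : seq nat) :
  (0 < m < n)%N -> uniq k -> (forall j : nat, j \in k -> (1 <= j < m)%N) ->
  minus_one_roots ('X^m - 1 - \sum_(j <- k) 'X^j) =
    (z ^+ (n - m) |` [fset z ^+ (n - m + j) | j in k])%fset.
Proof.
move=> /andP[m0 mn] uk kP; set f := 'X^m - _ - _.
(* The constant term -1 is absorbed as one more exponent 0, which is not in [k]; as [k] has no
   repetition, every selected coefficient is exactly -1. *)
have coeff j : f`_j = (j == m)%:R - ((j < m)%N && (j \in 0%N :: k))%:R.
  rewrite /f !coefB coefXn coef1.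
  have -> : \sum_(i <- k) 'X^i = \sum_(i <- k) 1 *: 'X^i :> {poly int}.
    by apply: eq_bigr => i _; rewrite scale1r.
  rewrite coef_sumZXn// inE.
  have [jk|jk] := boolP (j \in k).
    by have /andP[j0 jm] := kP j jk; rewrite jm (gtn_eqF j0) subr0.
  rewrite orbF !subr0; case: (posnP j) => [->|j0]; first by rewrite m0.
  by rewrite andbF.
have [sf _ _ _] : calA_shape m f by exact: calA_shape_coef coeff.
have -> : (z ^+ (n - m) |` [fset z ^+ (n - m + j) | j in k])%fset =
          [fset z ^+ (n - m + j) | j in 0%N :: k]%fset.
  apply/fsetP => x; rewrite in_fset1U; apply/orP/imfsetP => /=.
    case=> [/eqP->|/imfsetP[j /= jk ->]].
      by exists 0%N; rewrite ?addn0 ?mem_head.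
    by exists j; rewrite // inE jk orbT.
  case=> j; rewrite inE => /predU1P[->|jk] ->; first by left; rewrite addn0.
  by right; apply/imfsetP; exists j.
rewrite /minus_one_roots sf; apply/fsetP => x.
apply/imfsetP/imfsetP => -[j /= jk ->].
  exists j => //; move: jk; rewrite mem_filter mem_iota /= add0n => /andP[fj jm].
  by move: fj; rewrite coeff jm ltn_eqF//; case: (j \in _).
have jm : (j < m)%N by move: jk; rewrite inE => /predU1P[->//|/kP/andP[]].
by exists j; rewrite // mem_filter mem_iota /= add0n jm coeff jm jk ltn_eqF.
Qed.

End Correspondence.

Theorem theorem3p9 (R : realType) (n : nat) (hn : (0 < n)%N) :
  exists F : {poly int} -> {fset R[i]},
    set_bij (calA n) (calB R n) F /\
    forall (m : nat) (k : seq nat),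
      (0 < m < n)%N ->
      sorted ltn k ->
      (forall j : nat, j \in k -> (1 <= j < m)%N) ->
      calA n ('X^m - 1 - \sum_(j <- k) 'X^j) ->
      F ('X^m - 1 - \sum_(j <- k) 'X^j) =
        (zeta R n ^+ (n - m) |` [fset zeta R n ^+ (n - m + j) | j in k])%fset.
Proof.
exists (minus_one_roots R n); split; first exact: minus_one_roots_bij.
move=> m k mn sk kP _; apply: minus_one_roots_explicit => //.
exact: (sorted_uniq ltn_trans ltnn).
Qed.
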